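(* Let $d\ge1$, $\beta>0$ and $\rho\in(0,\infty)$, and consider the variational problem $\inf_{Q\in\mathcal{M}}\mathcal{S}(Q)$. (1) For any $\rho<\infty$ in dimensions $d=1,2$, and for any $\rho<\rho_c$ in dimensions $d\ge3$, there is a unique minimiser $Q\in\mathcal{M}$ of this variational problem, with $$\widehat Q(k)=\frac{e^{-\alpha k}}{\rho(4\pi\beta)^{d/2}k^{1+\frac d2}}\qquad\text{for } k\in\mathbb{N}.$$ (2) For dimensions $d\ge3$ and densities $\rho>\rho_c$, there is no minimiser for the variational problem, but the infimum is attained for any minimising sequence $(Q_n)_{n\in\mathbb{N}}$ of $Q_n\in\mathcal{M}$ such that $Q_n\to Q^*$ as $n\to\infty$. (3) The specific free energy $f(\beta,\rho)$ is given for $d\ge3$ by $$f(\beta,\rho)=\begin{cases}-\dfrac{1}{(4\pi\beta)^{d/2}\beta}\,g_{\frac{d+2}2}(\alpha)-\dfrac1\beta\rho\alpha & \text{for }\rho<\rho_c,\\[2ex]-\dfrac{1}{(4\pi\beta)^{d/2}\beta}\,\zeta\Big(\dfrac{d+2}{2}\Big)&\text{for }\rho>\rho_c,\end{cases}$$ and for $d=1,2$ by $$f(\beta,\rho)=-\frac{1}{(4\pi\beta)^{d/2}\beta}\,g_{\frac{d+2}2}(\alpha)-\frac{\rho\alpha}{\beta}.$$ Here, whenever $\rho<\rho_c$, $\alpha=\alpha(\beta,\rho)$ is the unique root of $\rho=\frac{1}{(4\pi\beta)^{d/2}}\sum_{k=1}^\infty k^{-d/2}e^{-\alpha k}$.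
   Context: $\mathbb{N}=\{1,2,\dots\}$. $\mathcal{M}=\{Q\in[0,1]^{\mathbb{N}}:\sum_{l\in\mathbb{N}}Q(l)=1,\ Q(l)\ge Q(l+1)\ \forall l\in\mathbb{N}\}$; for $Q\in\mathcal{M}$, $\widehat Q(k)=Q(k)-Q(k+1)$, $k\in\mathbb{N}$. Let $$\widehat Q^*(k)=\frac{1}{\rho(4\pi\beta)^{d/2}k^{1+d/2}},\qquad Q^*(k)=\sum_{l\ge k}\widehat Q^*(l),\qquad k\in\mathbb{N},$$ and $$\mathcal{S}(Q)=\sum_{k=1}^\infty\widehat Q(k)\Big(\log\frac{\widehat Q(k)}{\widehat Q^*(k)}-1\Big),\qquad Q\in\mathcal{M},$$ with $0\log0=0$. The critical density is $\rho_c=\frac{1}{(4\pi\beta)^{d/2}}\zeta(d/2)$ for $d\ge3$ and $\rho_c=+\infty$ for $d=1,2$, where $\zeta$ is the Riemann zeta function. The Bose functions are $g_s(\alpha)=\sum_{k=1}^\infty k^{-s}e^{-\alpha k}$ for $\alpha>0$, $s>0$. The specific free energy at inverse temperature $\beta$ and density $\rho$ is $$f(\beta,\rho)=\frac{\rho}{\beta}\inf_{Q\in\mathcal{M}}\mathcal{S}(Q).$$ *)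

(* Defs.v *)
From Stdlib Require Import Reals Lra Lia.
From Coquelicot Require Import Coquelicot.
Open Scope R_scope.

(* A sequence (x(k)), k = 1, 2, 3, ..., is encoded as [x : nat -> R] with
   [x n] standing for x(n+1); [idx n] is the real number n+1. *)
Definition idx (n : nat) : R := INR (S n).

Definition in_M (Q : nat -> R) : Prop :=
  (forall n, 0 <= Q n <= 1) /\ is_series Q 1 /\ (forall n, Q (S n) <= Q n).

Definition hat (Q : nat -> R) (n : nat) : R := Q n - Q (S n).

(* (4 pi beta)^(d/2) *)
Definition thermal (d : nat) (beta : R) : R :=
  Rpower (4 * PI * beta) (INR d / 2).

Definition hatQstar (d : nat) (beta rho : R) (n : nat) : R :=
  / (rho * thermal d beta * Rpower (idx n) (1 + INR d / 2)).

Definition Qstar (d : nat) (beta rho : R) (n : nat) : R :=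
  Series (fun l => hatQstar d beta rho (n + l)).

(* The convention 0 log 0 = 0 holds because the logarithm is multiplied by 0. *)
Definition calS_term (d : nat) (beta rho : R) (Q : nat -> R) (n : nat) : R :=
  hat Q n * (ln (hat Q n / hatQstar d beta rho n) - 1).

(* On [in_M] this series converges absolutely: see [ex_series_calS]. *)
Definition calS (d : nat) (beta rho : R) (Q : nat -> R) : R :=
  Series (calS_term d beta rho Q).

Definition infS (d : nat) (beta rho : R) : Rbar :=
  Glb_Rbar (fun s => exists Q, in_M Q /\ s = calS d beta rho Q).

Definition minimiser (d : nat) (beta rho : R) (Q : nat -> R) : Prop :=
  in_M Q /\ forall Q', in_M Q' -> calS d beta rho Q <= calS d beta rho Q'.

(* Convergence in the product topology of [0,1]^N. *)
Definition converges (Qn : nat -> nat -> R) (Q : nat -> R) : Prop :=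
  forall k, is_lim_seq (fun n => Qn n k) (Q k).

(* The Riemann zeta function on the half-line s > 1, the only place where it is
   evaluated. *)
Definition zeta (s : R) : R := Series (fun n => Rpower (idx n) (- s)).

(* Meaningful (convergent) for alpha > 0. *)
Definition bose (s alpha : R) : R :=
  Series (fun n => Rpower (idx n) (- s) * exp (- alpha * idx n)).

Definition rho_c (d : nat) (beta : R) : Rbar :=
  if (d <=? 2)%nat then p_infty
  else Finite (/ thermal d beta * zeta (INR d / 2)).

Definition is_alpha (d : nat) (beta rho alpha : R) : Prop :=
  0 < alpha /\ rho = / thermal d beta * bose (INR d / 2) alpha.

Definition free_energy (d : nat) (beta rho : R) : Rbar :=
  Rbar_mult (Finite (rho / beta)) (infS d beta rho).

Lemma idx_ge1 n : 1 <= idx n.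
Proof. unfold idx; rewrite S_INR; pose proof (pos_INR n); lra. Qed.

Lemma ln_le_sub1 x : 0 < x -> ln x <= x - 1.
Proof.
intros hx; pose proof (exp_ineq1_le (ln x)) as h.
rewrite exp_ln in h by exact hx; lra.
Qed.

Lemma sum_idx_hat (Q : nat -> R) n :
  sum_n (fun k => idx k * hat Q k) n = sum_n Q n - idx n * Q (S n).
Proof.
induction n as [|n IH].
- rewrite !sum_O; unfold idx, hat; simpl; ring.
- rewrite !sum_Sn, IH; unfold plus, idx, hat; simpl plus.
  rewrite (S_INR (S n)); simpl; ring.
Qed.

Lemma sum_n_bounded_ex_series (a : nat -> R) (B : R) :
  (forall n, 0 <= a n) -> (forall n, sum_n a n <= B) -> ex_series a.
Proof.
intros h0 hB.
destruct (ex_finite_lim_seq_incr (sum_n a) B) as [l hl].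
- intros n; rewrite sum_Sn; unfold plus; simpl; specialize (h0 (S n)); lra.
- exact hB.
- exists l; exact hl.
Qed.

Lemma ex_series_idx_hat Q : in_M Q -> ex_series (fun n => idx n * hat Q n).
Proof.
intros [h01 [hs hdec]].
apply (sum_n_bounded_ex_series _ 1).
- intros n; unfold hat; pose proof (idx_ge1 n); specialize (hdec n).
  apply Rmult_le_pos; lra.
- intros n; rewrite sum_idx_hat.
  assert (hp : 0 <= idx n * Q (S n)).
  { pose proof (idx_ge1 n); apply Rmult_le_pos; [lra|apply h01]. }
  assert (sum_n Q n <= 1); [|lra].
  apply (is_lim_seq_incr_compare (sum_n Q) 1); [exact hs|].
  intros m; rewrite sum_Sn; unfold plus; simpl; specialize (h01 (S m)); lra.
Qed.

Lemma ex_series_inv_sqr : ex_series (fun n => / (idx n * idx n)).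
Proof.
apply (sum_n_bounded_ex_series _ 2).
- intros n; pose proof (idx_ge1 n); left; apply Rinv_0_lt_compat; nra.
- intros n; apply Rle_trans with (2 - / idx n).
  + induction n as [|n IH].
    * rewrite sum_O; unfold idx; simpl; lra.
    * rewrite sum_Sn; unfold plus; simpl.
      pose proof (idx_ge1 n) as h1.
      assert (he : idx (S n) = idx n + 1) by (unfold idx; rewrite (S_INR (S n)); reflexivity).
      rewrite he.
      assert (/ ((idx n + 1) * (idx n + 1)) <= / idx n - / (idx n + 1)); [|lra].
      replace (/ idx n - / (idx n + 1)) with (/ (idx n * (idx n + 1))) by (field; lra).
      apply Rinv_le_contravar; nra.
  + pose proof (idx_ge1 n); assert (0 < / idx n) by (apply Rinv_0_lt_compat; lra); lra.
Qed.

Lemma ex_series_calS d beta rho Q : 0 < beta -> 0 < rho -> in_M Q ->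
  ex_series (fun n => Rabs (calS_term d beta rho Q n)).
Proof.
intros hb hr hQ.
set (c := rho * thermal d beta).
assert (hc : 0 < c) by (apply Rmult_lt_0_compat; [exact hr|apply exp_pos]).
set (e := 1 + INR d / 2).
assert (he : 0 < e) by (unfold e; pose proof (pos_INR d); lra).
set (K := 3 + Rabs (ln c) + e).
apply (@ex_series_le R_AbsRing R_CompleteNormedModule _
  (fun n => K * (idx n * hat Q n) + / (idx n * idx n))).
2:{ apply (ex_series_plus (V := R_NormedModule) (fun n => K * (idx n * hat Q n))).
    - apply (ex_series_scal (V := R_NormedModule) K), ex_series_idx_hat, hQ.
    - exact ex_series_inv_sqr. }
intros n; change (Rabs (Rabs (calS_term d beta rho Q n))
  <= K * (idx n * hat Q n) + / (idx n * idx n)).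
rewrite Rabs_Rabsolu.
destruct hQ as [h01 [_ hdec]].
pose proof (idx_ge1 n) as hk.
assert (hi : 0 < / (idx n * idx n)) by (apply Rinv_0_lt_compat; nra).
unfold calS_term.
assert (hx0 : 0 <= hat Q n) by (unfold hat; specialize (hdec n); lra).
assert (hx1 : hat Q n <= 1).
{ unfold hat; pose proof (h01 n); pose proof (h01 (S n)); lra. }
unfold hatQstar; fold c; fold e.
revert hx0 hx1; generalize (hat Q n); intros x hx0 hx1.
set (k := idx n) in *; clearbody k.
assert (hlk : 0 <= ln k) by (rewrite <- ln_1; apply ln_le; lra).
assert (hlk' : ln k <= k) by (pose proof (ln_le_sub1 k ltac:(lra)); lra).
assert (hK : 0 <= K * (k * x)).
{ unfold K; pose proof (Rabs_pos (ln c)).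
  apply Rmult_le_pos; [lra|apply Rmult_le_pos; lra]. }
destruct hx0 as [hx0|<-].
2:{ rewrite Rmult_0_l, Rabs_R0; lra. }
assert (hp : 0 < Rpower k e) by apply exp_pos.
unfold Rdiv; rewrite Rinv_inv, ln_mult, ln_mult; try lra; try (apply Rmult_lt_0_compat; lra).
unfold Rpower; rewrite ln_exp.
assert (hxl : ln x <= 0) by (rewrite <- ln_1; apply ln_le; lra).
assert (hy : - (x * ln x) <= 2 * (x * ln k) - x + / (k * k)).
{ assert (hkk : 0 < x * (k * k)) by (repeat apply Rmult_lt_0_compat; lra).
  pose proof (ln_le_sub1 (/ (x * (k * k)))) as h.
  assert (hinv : 0 < / (x * (k * k))) by (apply Rinv_0_lt_compat; exact hkk).
  specialize (h hinv).
  rewrite ln_Rinv, ln_mult, ln_mult in h by (try exact hkk; try lra; nra).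
  apply Rmult_le_compat_l with (r := x) in h; [|lra].
  replace (x * (/ (x * (k * k)) - 1)) with (/ (k * k) - x) in h by (field; lra).
  lra. }
assert (hxk : x * ln k <= k * x) by nra.
assert (hxk0 : 0 <= x * ln k) by nra.
assert (hekx : e * (x * ln k) <= e * (k * x)) by nra.
assert (hekx0 : 0 <= e * (x * ln k)) by nra.
assert (hxx : x <= k * x) by nra.
assert (hcx : Rabs (x * ln c) <= Rabs (ln c) * (k * x)).
{ rewrite Rabs_mult, (Rabs_pos_eq x) by lra.
  pose proof (Rabs_pos (ln c)); nra. }
apply Rabs_le_between in hcx.
apply Rabs_le; unfold K.
assert (x * ln x <= 0) by nra.
split; nra.
Qed.

(* Main.v *)
Require Import Defs.
From Stdlib Require Import Reals Lra Lia FunctionalExtensionality.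
From Coquelicot Require Import Coquelicot.
Open Scope R_scope.

(** The sequence [Q] enters the functional only through its increments
    [h = hat Q], and summation by parts turns the normalisation of [Q] into the
    first moment condition [sum idx n * h n = 1] ([is_series_idx_hat]);
    conversely, tail sums of nonnegative weights with first moment [1] lie in
    [in_M] ([in_M_tail]).

    Under this condition the reference weights [q = hatQstar] can be replaced
    by the tilted weights [p n = exp (- alpha * idx n) * q n] at the cost of
    the constant [- alpha]. The elementary inequality
    [x * (ln (x / p) - 1) >= - p], with equality only at [x = p], then gives
    [calS Q >= - sum p - alpha], with equality exactly when [hat Q = p]
    ([calS_ge], [calS_eq_hat], [calS_of_hat]).

    If [alpha > 0] solves the density equation, then [p] has first moment [1],
    so the tail sums of [p] are the unique minimiser and the free energy is
    explicit. Such an [alpha] exists below the critical density because the Bose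
    function is continuous, strictly decreasing in [alpha], and approaches the
    (possibly divergent) sum of [k ^ (- d / 2)] as [alpha] tends to [0].

    Above the critical density one takes [alpha = 0]. The bound [- sum q] is not
    attained, since [q] has first moment [rho_c / rho < 1], but it is approached:
    along any sequence in [in_M] that converges pointwise to [Qstar], every
    partial sum of the functional converges, while the first moment bound makes
    the positive part of the remainder uniformly small ([calS_le_partial]). The
    missing mass escapes to infinity without contributing to the functional
    ([is_lim_seq_calS]). *)

(** * Real series *)

Lemma sum_n_S (a : nat -> R) n : sum_n a (S n) = sum_n a n + a (S n).
Proof. rewrite sum_Sn; reflexivity. Qed.

Lemma sum_n_nonneg (a : nat -> R) n : (forall k, 0 <= a k) -> 0 <= sum_n a n.
Proof.
intros h; induction n as [|n IH].
- rewrite sum_O; apply h.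
- rewrite sum_n_S; specialize (h (S n)); lra.
Qed.

Lemma sum_n_le_is_series (a : nat -> R) (l : R) n :
  (forall k, 0 <= a k) -> is_series a l -> sum_n a n <= l.
Proof.
intros h0 hs; apply (is_lim_seq_incr_compare (sum_n a) l); [exact hs|].
intros m; rewrite sum_n_S; specialize (h0 (S m)); lra.
Qed.

Lemma term_le_is_series (a : nat -> R) (l : R) n :
  (forall k, 0 <= a k) -> is_series a l -> a n <= l.
Proof.
intros h0 hs; apply Rle_trans with (2 := sum_n_le_is_series a l n h0 hs).
destruct n as [|n]; [rewrite sum_O; lra|].
rewrite sum_n_S; pose proof (sum_n_nonneg a n h0); lra.
Qed.

Lemma is_series_0_terms (a : nat -> R) :
  (forall k, 0 <= a k) -> is_series a 0 -> forall n, a n = 0.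
Proof.
intros h0 hs n; pose proof (term_le_is_series a 0 n h0 hs); specialize (h0 n); lra.
Qed.

Lemma is_series_eq (a b : nat -> R) (la lb : R) :
  is_series a la -> (forall n, a n = b n) -> la = lb -> is_series b lb.
Proof. intros h hab <-; exact (is_series_ext a b la hab h). Qed.

Lemma is_series_add (a b : nat -> R) (la lb : R) :
  is_series a la -> is_series b lb -> is_series (fun n => a n + b n) (la + lb).
Proof. exact (is_series_plus a b la lb). Qed.

Lemma is_series_mul (c : R) (a : nat -> R) (la : R) :
  is_series a la -> is_series (fun n => c * a n) (c * la).
Proof. exact (is_series_scal_l c a la). Qed.

Lemma ex_series_dominated (a b : nat -> R) :
  (forall n, 0 <= a n <= b n) -> ex_series b -> ex_series a.
Proof.
intros h; apply (@ex_series_le R_AbsRing R_CompleteNormedModule).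
intros n; change (Rabs (a n) <= b n); rewrite Rabs_pos_eq; apply h.
Qed.

(** * Decreasing sequences and their increments *)

Lemma idx_S n : idx (S n) = idx n + 1.
Proof. unfold idx; rewrite (S_INR (S n)); reflexivity. Qed.

Lemma idx_le n m : (n <= m)%nat -> idx n <= idx m.
Proof. intros h; apply le_INR; lia. Qed.

Lemma hat_nonneg Q n : in_M Q -> 0 <= hat Q n.
Proof. intros [_ [_ h]]; unfold hat; specialize (h n); lra. Qed.

Lemma hat_le_1 Q n : in_M Q -> hat Q n <= 1.
Proof. intros [h _]; unfold hat; pose proof (h n); pose proof (h (S n)); lra. Qed.

Lemma in_M_lim Q : in_M Q -> is_lim_seq Q 0.
Proof. intros [_ [h _]]; apply ex_series_lim_0; exists 1; exact h. Qed.

(** Every increment beyond position [n] carries a weight at least [idx n] in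
    the weighted sum of increments, so [idx n * Q (S n)] is at most a tail of
    a convergent series. *)
Lemma is_lim_seq_idx_mul (Q : nat -> R) (T : R) :
  (forall n, Q (S n) <= Q n) -> is_lim_seq Q 0 ->
  is_series (fun n => idx n * hat Q n) T ->
  is_lim_seq (fun n => idx n * Q (S n)) 0.
Proof.
intros hdec hlim hs.
set (w := fun n => idx n * hat Q n) in *.
assert (hpos : forall n, 0 <= Q n)
  by (intros n; exact (is_lim_seq_decr_compare Q 0 hlim hdec n)).
assert (hfin : forall n j,
  idx n * (Q (S n) - Q (j + S n)%nat) <= sum_n w (j + n) - sum_n w n).
{ intros n j; induction j as [|j IH].
  - simpl; lra.
  - rewrite !Nat.add_succ_l, sum_n_S; unfold w at 2; unfold hat.
    replace (j + S n)%nat with (S (j + n)) in * by lia.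
    pose proof (hdec (S (j + n))); pose proof (idx_ge1 n).
    pose proof (idx_le n (S (j + n)) ltac:(lia)); nra. }
assert (htail : forall n, idx n * Q (S n) <= T - sum_n w n).
{ intros n.
  assert (h := is_lim_seq_le _ _ (idx n * (Q (S n) - 0)) (T - sum_n w n) (hfin n)).
  rewrite <- (Rminus_0_r (Q (S n))); apply h.
  - apply (is_lim_seq_scal_l _ (idx n) (Q (S n) - 0)), is_lim_seq_minus'.
    + apply is_lim_seq_const.
    + exact (proj1 (is_lim_seq_incr_n Q (S n) 0) hlim).
  - apply is_lim_seq_minus'.
    + exact (proj1 (is_lim_seq_incr_n (sum_n w) n T) hs).
    + apply is_lim_seq_const. }
apply is_lim_seq_le_le with (u := fun _ => 0) (w := fun n => T - sum_n w n).
- intros n; split; [|apply htail].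
  pose proof (idx_ge1 n); apply Rmult_le_pos; [lra|apply hpos].
- apply is_lim_seq_const.
- replace (Finite 0) with (Finite (T - T)) by (f_equal; ring).
  apply is_lim_seq_minus'; [apply is_lim_seq_const|exact hs].
Qed.

(** Summation by parts: the boundary term vanishes in the limit. *)
Lemma is_series_of_increments (Q : nat -> R) (T : R) :
  (forall n, Q (S n) <= Q n) -> is_lim_seq Q 0 ->
  is_series (fun n => idx n * hat Q n) T -> is_series Q T.
Proof.
intros hdec hlim hs.
assert (h0 := is_lim_seq_idx_mul Q T hdec hlim hs).
change (is_lim_seq (sum_n Q) T).
apply is_lim_seq_ext with
  (u := fun n => sum_n (fun k => idx k * hat Q k) n + idx n * Q (S n)).
- intros n; rewrite sum_idx_hat; ring.
- replace T with (T + 0) by ring.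
  apply is_lim_seq_plus'; [exact hs|exact h0].
Qed.

(** In terms of the increments, the normalisation of [Q] is a first moment
    condition; this is the constraint whose Lagrange multiplier is [alpha]. *)
Lemma is_series_idx_hat Q : in_M Q -> is_series (fun n => idx n * hat Q n) 1.
Proof.
intros hQ; destruct (ex_series_idx_hat Q hQ) as [T hT].
assert (h := is_series_of_increments Q T (proj2 (proj2 hQ)) (in_M_lim Q hQ) hT).
destruct hQ as [_ [hQ _]].
apply is_series_unique in h; apply is_series_unique in hQ.
rewrite <- hQ, h; exact hT.
Qed.

(** Equal increments make the difference constant, and both limits vanish. *)
Lemma hat_inj (Q Q' : nat -> R) :
  is_lim_seq Q 0 -> is_lim_seq Q' 0 -> (forall n, hat Q n = hat Q' n) -> Q = Q'.
Proof.
intros h h' heq; apply functional_extensionality.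
assert (hd : forall n, Q n - Q' n = Q O - Q' O).
{ intros n; induction n as [|n IH]; [reflexivity|].
  specialize (heq n); unfold hat in heq; lra. }
assert (hl : Q O - Q' O = 0).
{ assert (h1 := is_lim_seq_minus' _ _ _ _ h h').
  apply (is_lim_seq_ext _ (fun _ => Q O - Q' O) _ hd), is_lim_seq_unique in h1.
  rewrite Lim_seq_const in h1; injection h1; lra. }
intros n; specialize (hd n); lra.
Qed.

(** [Qstar d beta rho] is, by definition, the [tail] of [hatQstar d beta rho]. *)
Definition tail (h : nat -> R) (n : nat) : R := Series (fun l => h (n + l)%nat).

Lemma ex_series_shift (h : nat -> R) n :
  ex_series h -> ex_series (fun l => h (n + l)%nat).
Proof. exact (proj1 (ex_series_incr_n h n)). Qed.

Lemma hat_tail (h : nat -> R) n : ex_series h -> hat (tail h) n = h n.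
Proof.
intros hs; unfold hat, tail.
rewrite (Series_incr_1 (fun l => h (n + l)%nat) (ex_series_shift h n hs)).
rewrite Nat.add_0_r, (Series_ext (fun l => h (n + S l)%nat) (fun l => h (S n + l)%nat)).
- ring.
- intros l; f_equal; lia.
Qed.

Lemma tail_S (h : nat -> R) n : ex_series h -> tail h (S n) = Series h - sum_n h n.
Proof.
intros hs; unfold tail; rewrite (Series_incr_n h (S n)) by (lia || exact hs).
rewrite sum_n_Reals; simpl Init.Nat.pred; ring.
Qed.

Lemma is_lim_seq_tail (h : nat -> R) : ex_series h -> is_lim_seq (tail h) 0.
Proof.
intros hs; apply is_lim_seq_incr_1.
apply is_lim_seq_ext with (u := fun n => Series h - sum_n h n).
- intros n; symmetry; apply tail_S, hs.
- replace (Finite 0) with (Finite (Series h - Series h)) by (f_equal; ring).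
  apply is_lim_seq_minus'; [apply is_lim_seq_const|exact (Series_correct h hs)].
Qed.

Lemma ex_series_of_moment (h : nat -> R) :
  (forall n, 0 <= h n) -> ex_series (fun n => idx n * h n) -> ex_series h.
Proof.
intros h0; apply ex_series_dominated.
intros n; specialize (h0 n); pose proof (idx_ge1 n); nra.
Qed.

Lemma tail_decr (h : nat -> R) n :
  (forall n, 0 <= h n) -> ex_series h -> tail h (S n) <= tail h n.
Proof.
intros h0 hs; assert (e := hat_tail h n hs); unfold hat in e; specialize (h0 n); lra.
Qed.

Lemma tail_nonneg (h : nat -> R) n :
  (forall n, 0 <= h n) -> ex_series h -> 0 <= tail h n.
Proof.
intros h0 hs; exact (is_lim_seq_decr_compare (tail h) 0 (is_lim_seq_tail h hs)
  (fun n => tail_decr h n h0 hs) n).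
Qed.

Lemma is_series_tail (h : nat -> R) (T : R) :
  (forall n, 0 <= h n) -> is_series (fun n => idx n * h n) T -> is_series (tail h) T.
Proof.
intros h0 hm.
assert (hs : ex_series h) by (apply ex_series_of_moment; [exact h0|exists T; exact hm]).
apply is_series_of_increments.
- intros n; apply tail_decr; assumption.
- apply is_lim_seq_tail, hs.
- apply is_series_eq with (1 := hm); [|reflexivity].
  intros n; rewrite hat_tail by exact hs; reflexivity.
Qed.

Lemma in_M_intro (Q : nat -> R) :
  (forall n, 0 <= Q n) -> (forall n, Q (S n) <= Q n) -> is_series Q 1 -> in_M Q.
Proof.
intros h0 hdec hs; split; [|split; assumption].
intros n; split; [apply h0|apply term_le_is_series; assumption].
Qed.

Lemma in_M_tail (h : nat -> R) :
  (forall n, 0 <= h n) -> is_series (fun n => idx n * h n) 1 -> in_M (tail h).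
Proof.
intros h0 hm.
assert (hs : ex_series h) by (apply ex_series_of_moment; [exact h0|exists 1; exact hm]).
apply in_M_intro.
- intros n; apply tail_nonneg; assumption.
- intros n; apply tail_decr; assumption.
- apply is_series_tail; assumption.
Qed.

(** * The Gibbs inequality *)

Lemma ln_lt_sub1 x : 0 < x -> x <> 1 -> ln x < x - 1.
Proof.
intros hx hne; assert (hl : ln x <> 0).
{ intros h; apply hne; rewrite <- (exp_ln x hx), h; apply exp_0. }
apply exp_ineq1 in hl; rewrite exp_ln in hl by exact hx; lra.
Qed.

Lemma relative_entropy_ge x p : 0 <= x -> 0 < p -> - p <= x * (ln (x / p) - 1).
Proof.
intros [hx|<-] hp; [|lra].
assert (h := ln_le_sub1 (p / x) ltac:(apply Rdiv_lt_0_compat; lra)).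
replace (ln (x / p)) with (- ln (p / x)).
- apply Rmult_le_compat_l with (r := x) in h; [|lra].
  replace (x * (p / x - 1)) with (p - x) in h by (field; lra); lra.
- rewrite !ln_div by lra; ring.
Qed.

Lemma relative_entropy_eq x p :
  0 <= x -> 0 < p -> x * (ln (x / p) - 1) = - p -> x = p.
Proof.
intros [hx|<-] hp he; [|lra].
destruct (Req_dec x p) as [h|hne]; [exact h|exfalso].
assert (h := ln_lt_sub1 (p / x) ltac:(apply Rdiv_lt_0_compat; lra)).
replace (ln (x / p)) with (- ln (p / x)) in he.
- assert (h1 : p / x <> 1).
  { intros h1; apply hne; replace p with (p / x * x) by (field; lra); rewrite h1; ring. }
  apply h, Rmult_lt_compat_l with (r := x) in h1; [|lra].
  replace (x * (p / x - 1)) with (p - x) in h1 by (field; lra); lra.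
- rewrite !ln_div by lra; ring.
Qed.

Lemma hatQstar_pos d beta rho n : 0 < rho -> 0 < hatQstar d beta rho n.
Proof.
intros hr; apply Rinv_0_lt_compat.
repeat apply Rmult_lt_0_compat; [exact hr|apply exp_pos|apply exp_pos].
Qed.

(** The Gibbs weights: [alpha] is conjugate to the first moment. *)
Definition tilted (d : nat) (beta rho alpha : R) (n : nat) : R :=
  exp (- alpha * idx n) * hatQstar d beta rho n.

Lemma tilted_pos d beta rho alpha n : 0 < rho -> 0 < tilted d beta rho alpha n.
Proof. intros hr; apply Rmult_lt_0_compat; [apply exp_pos|apply hatQstar_pos, hr]. Qed.

Lemma calS_term_tilted d beta rho alpha Q n : 0 < rho -> 0 <= hat Q n ->
  calS_term d beta rho Q n
  = hat Q n * (ln (hat Q n / tilted d beta rho alpha n) - 1) - alpha * (idx n * hat Q n).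
Proof.
intros hr; unfold calS_term, tilted; intros [hx|<-]; [|ring].
pose proof (hatQstar_pos d beta rho n hr) as hq.
pose proof (exp_pos (- alpha * idx n)).
rewrite !ln_div by (try apply Rmult_lt_0_compat; assumption).
rewrite ln_mult, ln_exp by assumption; ring.
Qed.

Lemma is_series_calS d beta rho Q : 0 < beta -> 0 < rho -> in_M Q ->
  is_series (calS_term d beta rho Q) (calS d beta rho Q).
Proof. intros hb hr hQ; apply Series_correct, ex_series_Rabs, ex_series_calS; assumption. Qed.

Section Gibbs.

Context (d : nat) (beta rho alpha L : R) (hb : 0 < beta) (hr : 0 < rho).
Context (hL : is_series (tilted d beta rho alpha) L).

Let is_series_gap Q : in_M Q ->
  is_series
    (fun n => hat Q n * (ln (hat Q n / tilted d beta rho alpha n) - 1)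
              + tilted d beta rho alpha n)
    (calS d beta rho Q + (L + alpha)).
Proof.
intros hQ.
assert (h := is_series_add _ _ _ _ (is_series_calS d beta rho Q hb hr hQ)
  (is_series_add _ _ _ _ hL (is_series_mul alpha _ _ (is_series_idx_hat Q hQ)))).
apply is_series_eq with (1 := h); [|ring].
intros n; rewrite (calS_term_tilted d beta rho alpha Q n hr (hat_nonneg Q n hQ)); ring.
Qed.

Let gap_nonneg Q : in_M Q -> forall n,
  0 <= hat Q n * (ln (hat Q n / tilted d beta rho alpha n) - 1)
       + tilted d beta rho alpha n.
Proof.
intros hQ n; pose proof (relative_entropy_ge _ _ (hat_nonneg Q n hQ)
  (tilted_pos d beta rho alpha n hr)); lra.
Qed.

(** Replacing the reference weights by exponentially tilted ones changes the
    functional by [- alpha] times the first moment of the increments, which is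
    constant on [in_M]; the tilted functional is bounded termwise. *)
Lemma calS_ge Q : in_M Q -> - L - alpha <= calS d beta rho Q.
Proof.
intros hQ.
assert (h := Rle_trans _ _ _ (gap_nonneg Q hQ O)
  (term_le_is_series _ _ O (gap_nonneg Q hQ) (is_series_gap Q hQ))); lra.
Qed.

(** A series of nonnegative gaps with sum zero has only zero terms. *)
Lemma calS_eq_hat Q : in_M Q -> calS d beta rho Q = - L - alpha ->
  forall n, hat Q n = tilted d beta rho alpha n.
Proof.
intros hQ he n.
assert (h := is_series_gap Q hQ).
replace (calS d beta rho Q + (L + alpha)) with 0 in h by lra.
apply (fun h' => is_series_0_terms _ h' h n) in gap_nonneg as h1; [|exact hQ].
apply relative_entropy_eq; [apply hat_nonneg, hQ|apply tilted_pos, hr|lra].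
Qed.

Lemma calS_of_hat Q : in_M Q -> (forall n, hat Q n = tilted d beta rho alpha n) ->
  calS d beta rho Q = - L - alpha.
Proof.
intros hQ he.
assert (h := is_series_gap Q hQ).
apply is_series_unique in h.
rewrite (Series_ext _ (fun n => 0 * tilted d beta rho alpha n)) in h.
- rewrite Series_scal_l, Rmult_0_l in h; lra.
- intros n; rewrite he; pose proof (tilted_pos d beta rho alpha n hr) as hp.
  unfold Rdiv; rewrite Rinv_r, ln_1 by lra; ring.
Qed.

End Gibbs.

(** A lower bound approached by a sequence in [in_M] is the infimum, whether or
    not it is attained. *)
Lemma infS_eq d beta rho l (Qn : nat -> nat -> R) :
  (forall Q, in_M Q -> l <= calS d beta rho Q) -> (forall n, in_M (Qn n)) ->
  is_lim_seq (fun n => calS d beta rho (Qn n)) l -> infS d beta rho = Finite l.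
Proof.
intros hl hQ hlim; apply is_glb_Rbar_unique; split.
- intros s [Q [hM ->]]; exact (hl Q hM).
- intros b hb.
  assert (hn : forall n, Rbar_le b (calS d beta rho (Qn n))).
  { intros n; apply hb; exists (Qn n); split; [apply hQ|reflexivity]. }
  destruct b as [b| |]; [|exact (False_ind _ (hn O))|exact I].
  exact (is_lim_seq_le _ _ b l hn (is_lim_seq_const b) hlim).
Qed.

(** * Convergence of the functional along sequences tending to [Qstar] *)

Lemma ln_le_2_sqrt x : 0 < x -> ln x <= 2 * sqrt x.
Proof.
intros hx; pose proof (sqrt_lt_R0 x hx) as hs.
pose proof (ln_le_sub1 _ hs).
replace (ln x) with (2 * ln (sqrt x)); [lra|].
rewrite <- (sqrt_sqrt x) at 2 by lra; rewrite ln_mult by exact hs; ring.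
Qed.

(** Chosen so that [remainder_const d beta rho * sqrt (idx n)] bounds
    [- ln (hatQstar d beta rho n)]. *)
Definition remainder_const (d : nat) (beta rho : R) : R :=
  Rabs (ln (rho * thermal d beta)) + 2 * (1 + INR d / 2).

Lemma remainder_const_pos d beta rho : 0 < remainder_const d beta rho.
Proof.
unfold remainder_const; pose proof (Rabs_pos (ln (rho * thermal d beta))).
pose proof (pos_INR d); lra.
Qed.

(** Since [hat Q n <= 1], its own logarithm only helps, and that of the
    reference weight grows logarithmically, hence slower than [idx n] by a
    factor that tends to infinity. The first moment of the increments therefore
    controls the terms with a coefficient that vanishes as [n] grows. *)
Lemma calS_term_le d beta rho Q n : 0 < rho -> in_M Q ->
  calS_term d beta rho Q n
  <= remainder_const d beta rho / sqrt (idx n) * (idx n * hat Q n).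
Proof.
intros hr hQ; pose proof (idx_ge1 n) as hk.
assert (hs : 1 <= sqrt (idx n)) by (rewrite <- sqrt_1; apply sqrt_le_1; lra).
replace (remainder_const d beta rho / sqrt (idx n) * (idx n * hat Q n))
  with (hat Q n * (remainder_const d beta rho * sqrt (idx n))).
2:{ rewrite <- (sqrt_sqrt (idx n)) at 3 by lra; field; lra. }
unfold calS_term; destruct (hat_nonneg Q n hQ) as [hx|<-]; [|lra].
apply Rmult_le_compat_l; [lra|].
assert (hc : 0 < rho * thermal d beta) by (apply Rmult_lt_0_compat; [lra|apply exp_pos]).
rewrite ln_div by (assumption || apply hatQstar_pos, hr).
unfold hatQstar; rewrite ln_Rinv by (apply Rmult_lt_0_compat; [exact hc|apply exp_pos]).
rewrite ln_mult by (exact hc || apply exp_pos).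
unfold Rpower; rewrite ln_exp.
assert (ln (hat Q n) <= 0) by (rewrite <- ln_1; apply ln_le; [lra|apply hat_le_1, hQ]).
pose proof (ln_le_2_sqrt (idx n) ltac:(lra)).
pose proof (Rle_abs (ln (rho * thermal d beta))).
pose proof (Rabs_pos (ln (rho * thermal d beta))).
pose proof (pos_INR d).
unfold remainder_const; nra.
Qed.

Lemma calS_le_partial d beta rho Q N : 0 < beta -> 0 < rho -> in_M Q ->
  calS d beta rho Q
  <= sum_n (calS_term d beta rho Q) N + remainder_const d beta rho / sqrt (idx N).
Proof.
intros hb hr hQ.
set (K := remainder_const d beta rho / sqrt (idx N)).
set (w := fun n => idx n * hat Q n).
assert (hw : forall n, 0 <= w n).
{ intros n; pose proof (idx_ge1 n); apply Rmult_le_pos; [lra|apply hat_nonneg, hQ]. }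
assert (hsN : 0 < sqrt (idx N)) by (pose proof (idx_ge1 N); apply sqrt_lt_R0; lra).
assert (hK : 0 <= K).
{ pose proof (remainder_const_pos d beta rho); left; apply Rdiv_lt_0_compat; assumption. }
assert (hj : forall j, sum_n (calS_term d beta rho Q) (j + N)
  <= sum_n (calS_term d beta rho Q) N + K * (sum_n w (j + N) - sum_n w N)).
{ intros j; induction j as [|j IH]; [simpl; lra|].
  rewrite Nat.add_succ_l, !sum_n_S.
  assert (h := calS_term_le d beta rho Q (S (j + N)) hr hQ); fold (w (S (j + N))) in h.
  assert (remainder_const d beta rho / sqrt (idx (S (j + N))) <= K).
  { apply Rmult_le_compat_l; [left; apply remainder_const_pos|].
    apply Rinv_le_contravar; [exact hsN|].
    pose proof (idx_ge1 N); pose proof (idx_le N (S (j + N)) ltac:(lia)).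
    apply sqrt_le_1; lra. }
  specialize (hw (S (j + N))); nra. }
apply (is_lim_seq_le (fun j => sum_n (calS_term d beta rho Q) (j + N))
  (fun _ => sum_n (calS_term d beta rho Q) N + K)
  (calS d beta rho Q) (sum_n (calS_term d beta rho Q) N + K)).
- intros j; specialize (hj j).
  pose proof (sum_n_le_is_series w 1 (j + N) hw (is_series_idx_hat Q hQ)).
  pose proof (sum_n_nonneg w N hw); nra.
- exact (proj1 (is_lim_seq_incr_n _ N (calS d beta rho Q))
    (is_series_calS d beta rho Q hb hr hQ)).
- apply is_lim_seq_const.
Qed.

Lemma is_lim_seq_relative_entropy (u : nat -> R) p :
  0 < p -> is_lim_seq u p -> is_lim_seq (fun n => u n * (ln (u n / p) - 1)) (- p).
Proof.
intros hp hu.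
replace (- p) with (p * (ln (p / p) - 1))
  by (unfold Rdiv; rewrite Rinv_r, ln_1 by lra; ring).
apply (is_lim_seq_continuous (fun x => x * (ln (x / p) - 1))); [|exact hu].
apply continuity_pt_filterlim.
apply (@ex_derive_continuous R_AbsRing R_NormedModule (fun x => x * (ln (x / p) - 1)) p).
auto_derive; unfold Rdiv; rewrite Rinv_r by lra; lra.
Qed.

Section Semicontinuity.

Context (d : nat) (beta rho L : R) (hb : 0 < beta) (hr : 0 < rho).
Context (hL : is_series (hatQstar d beta rho) L).

Lemma is_series_tilted_0 : is_series (tilted d beta rho 0) L.
Proof.
apply is_series_eq with (1 := hL); [|reflexivity].
intros n; unfold tilted; rewrite Ropp_0, Rmult_0_l, exp_0; ring.
Qed.

Lemma hat_Qstar n : hat (Qstar d beta rho) n = hatQstar d beta rho n.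
Proof. apply hat_tail; exists L; exact hL. Qed.

Lemma is_lim_seq_partial_calS (Qn : nat -> nat -> R) N :
  converges Qn (Qstar d beta rho) ->
  is_lim_seq (fun n => sum_n (calS_term d beta rho (Qn n)) N)
    (- sum_n (hatQstar d beta rho) N).
Proof.
intros hc.
assert (ht : forall k, is_lim_seq (fun n => calS_term d beta rho (Qn n) k)
  (- hatQstar d beta rho k)).
{ intros k; apply (is_lim_seq_relative_entropy (fun n => hat (Qn n) k)).
  - apply hatQstar_pos, hr.
  - rewrite <- hat_Qstar; apply is_lim_seq_minus'; apply hc. }
induction N as [|N IH].
- rewrite sum_O; apply is_lim_seq_ext with (2 := ht O).
  intros n; rewrite sum_O; reflexivity.
- apply is_lim_seq_ext with
    (u := fun n => sum_n (calS_term d beta rho (Qn n)) N + calS_term d beta rho (Qn n) (S N)).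
  + intros n; rewrite sum_n_S; reflexivity.
  + rewrite sum_n_S, Ropp_plus_distr; apply is_lim_seq_plus'; [exact IH|apply ht].
Qed.

(** The lower bound is the Gibbs inequality without tilting. For the upper
    bound, finitely many terms converge and the first moment constraint
    controls the remainder uniformly along the sequence. *)
Lemma is_lim_seq_calS (Qn : nat -> nat -> R) :
  (forall n, in_M (Qn n)) -> converges Qn (Qstar d beta rho) ->
  is_lim_seq (fun n => calS d beta rho (Qn n)) (- L).
Proof.
intros hQ hc; apply is_lim_seq_spec; intros eps; pose proof (cond_pos eps) as he.
(* eps is split in three: the remainder, the distance of the partial sum of the
   reference weights from L, and the convergence of finitely many terms. *)
set (K := remainder_const d beta rho).
assert (hK : 0 < K) by apply remainder_const_pos.
destruct (proj2 (is_lim_seq_spec (sum_n (hatQstar d beta rho)) L) hL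
  (mkposreal (eps / 3) ltac:(lra))) as [N1 hN1].
destruct (INR_unbounded ((3 * K / eps) * (3 * K / eps))) as [N2 hN2].
(* N1 makes the partial sum of the reference weights close to L, N2 makes the
   uniform remainder bound K / sqrt (idx N) small. *)
set (N := max N1 N2).
specialize (hN1 N ltac:(lia)); simpl in hN1.
assert (hKN : K / sqrt (idx N) < eps / 3).
{ assert (h0 : 0 < 3 * K / eps) by (apply Rdiv_lt_0_compat; lra).
  assert (h : 3 * K / eps < sqrt (idx N)).
  { rewrite <- (sqrt_square (3 * K / eps)) by lra; apply sqrt_lt_1.
    - nra.
    - pose proof (idx_ge1 N); lra.
    - apply Rlt_le_trans with (1 := hN2); apply le_INR; lia. }
  apply Rmult_lt_reg_r with (sqrt (idx N)); [lra|].
  replace (K / sqrt (idx N) * sqrt (idx N)) with (3 * K / eps * (eps / 3)) by (field; lra).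
  nra. }
destruct (proj2 (is_lim_seq_spec _ _) (is_lim_seq_partial_calS Qn N hc)
  (mkposreal (eps / 3) ltac:(lra))) as [M hM].
exists M; intros n hn; specialize (hM n hn); simpl in hM.
pose proof (calS_ge d beta rho 0 L hb hr is_series_tilted_0 (Qn n) (hQ n)).
pose proof (calS_le_partial d beta rho (Qn n) N hb hr (hQ n)) as hle; fold K in hle.
apply Rabs_lt_between in hM; apply Rabs_lt_between in hN1; apply Rabs_lt_between; lra.
Qed.

End Semicontinuity.

(** * Escape of mass above the critical density *)

Lemma is_series_plateau (c : R) n :
  is_series (fun k => if (k <=? n)%nat then c else 0) (c * idx n).
Proof.
set (f := fun k => if (k <=? n)%nat then c else 0).
change (is_lim_seq (sum_n f) (c * idx n)).
assert (h : forall m, c * idx (min m n) = sum_n f m).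
{ intros m; induction m as [|m IH].
  - rewrite sum_O; unfold f, idx; simpl; ring.
  - rewrite sum_n_S, <- IH; unfold f; destruct (Nat.leb_spec (S m) n).
    + rewrite !Nat.min_l, idx_S by lia; ring.
    + rewrite !Nat.min_r by lia; ring. }
apply is_lim_seq_ext_loc with (u := fun _ => c * idx n); [|apply is_lim_seq_const].
exists n; intros m hm; rewrite <- h, Nat.min_r by exact hm; reflexivity.
Qed.

(** The mass [1 - m] missing from [Q] is spread evenly over the first [n + 1]
    entries: this keeps the sequence decreasing and disappears pointwise. *)
Lemma approximable (Q : nat -> R) (m : R) :
  (forall n, 0 <= Q n) -> (forall n, Q (S n) <= Q n) -> is_series Q m -> m <= 1 ->
  exists Qn : nat -> nat -> R, (forall n, in_M (Qn n)) /\ converges Qn Q.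
Proof.
intros h0 hdec hs hm.
exists (fun n k => Q k + (if (k <=? n)%nat then (1 - m) / idx n else 0)).
assert (hc : forall n, 0 <= (1 - m) / idx n).
{ intros n; pose proof (idx_ge1 n).
  apply Rmult_le_pos; [lra|left; apply Rinv_0_lt_compat; lra]. }
split.
- intros n; specialize (hc n); apply in_M_intro.
  + intros k; specialize (h0 k); destruct (k <=? n)%nat; lra.
  + intros k; specialize (hdec k).
    destruct (Nat.leb_spec (S k) n), (Nat.leb_spec k n); lra || lia.
  + apply is_series_eq
      with (1 := is_series_add _ _ _ _ hs (is_series_plateau ((1 - m) / idx n) n)).
    * reflexivity.
    * pose proof (idx_ge1 n); field; lra.
- intros k; apply is_lim_seq_le_le
    with (u := fun _ => Q k) (w := fun n => Q k + (1 - m) * / idx n).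
  + intros n; specialize (hc n); unfold Rdiv in *; destruct (k <=? n)%nat; lra.
  + apply is_lim_seq_const.
  + replace (Finite (Q k)) with (Finite (Q k + (1 - m) * 0)) by (f_equal; ring).
    apply is_lim_seq_plus'; [apply is_lim_seq_const|].
    apply (is_lim_seq_scal_l _ (1 - m) 0).
    apply (is_lim_seq_inv idx p_infty); [|discriminate].
    exact (proj1 (is_lim_seq_incr_1 INR p_infty) is_lim_seq_INR).
Qed.

(** * The zeta and Bose functions *)

Lemma Rpower_pos x y : 0 < Rpower x y.
Proof. apply exp_pos. Qed.

Lemma Rpower_idx_mul n s : idx n * Rpower (idx n) (- (1 + s)) = Rpower (idx n) (- s).
Proof.
pose proof (idx_ge1 n).
rewrite <- (Rpower_1 (idx n)) at 1 by lra.
rewrite <- Rpower_plus; f_equal; ring.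
Qed.

Lemma Rpower_idx_le_1 n s : 0 <= s -> Rpower (idx n) (- s) <= 1.
Proof.
intros hs; pose proof (idx_ge1 n) as h; rewrite <- (Rpower_O (idx n)) by lra.
apply Rle_Rpower; lra.
Qed.

Lemma ln_idx_step n : ln (idx (S n)) - ln (idx n) <= / idx n.
Proof.
pose proof (idx_ge1 n) as h; rewrite idx_S, <- ln_div by lra.
eapply Rle_trans; [apply ln_le_sub1, Rdiv_lt_0_compat; lra|].
right; field; lra.
Qed.

(** Comparison with the integral of [x ^ (- (1 + t))], in the form of the
    telescoping bound [t * k ^ (- (1 + t)) <= (k - 1) ^ (- t) - k ^ (- t)]. *)
Lemma ex_series_zeta s : 1 < s -> ex_series (fun n => Rpower (idx n) (- s)).
Proof.
intros hs; set (t := s - 1); assert (ht : 0 < t) by (unfold t; lra).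
assert (hstep : forall n, t * Rpower (idx (S n)) (- s)
  <= Rpower (idx n) (- t) - Rpower (idx (S n)) (- t)).
{ intros n; pose proof (idx_ge1 n) as h; pose proof (idx_S n) as hS.
  replace (- s) with (- (1 + t)) by (unfold t; ring).
  assert (hp := Rpower_pos (idx (S n)) (- t)).
  assert (hm := Rpower_idx_mul (S n) t).
  assert (hl : / idx (S n) <= ln (idx (S n)) - ln (idx n)).
  { pose proof (ln_le_sub1 (idx n / idx (S n)) ltac:(apply Rdiv_lt_0_compat; lra)) as h1.
    rewrite ln_div in h1 by lra.
    replace (idx n / idx (S n) - 1) with (- / idx (S n)) in h1 by (rewrite hS; field; lra).
    lra. }
  assert (he : Rpower (idx n) (- t)
    = Rpower (idx (S n)) (- t) * exp (t * (ln (idx (S n)) - ln (idx n)))).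
  { unfold Rpower; rewrite <- exp_plus; f_equal; ring. }
  pose proof (exp_ineq1_le (t * (ln (idx (S n)) - ln (idx n)))) as hx.
  assert (hmul : Rpower (idx (S n)) (- (1 + t)) = Rpower (idx (S n)) (- t) * / idx (S n)).
  { rewrite <- hm; field; lra. }
  apply Rmult_le_compat_l with (r := t) in hl; [|lra].
  rewrite hmul, he; nra. }
apply (sum_n_bounded_ex_series _ (1 + / t)).
- intros n; left; apply Rpower_pos.
- intros n; assert (hn : t * sum_n (fun n => Rpower (idx n) (- s)) n
    <= t + 1 - Rpower (idx n) (- t)).
  { induction n as [|n IH].
    - rewrite sum_O; replace (idx 0) with 1 by reflexivity.
      unfold Rpower; rewrite ln_1, !Rmult_0_r, exp_0; lra.
    - rewrite sum_n_S; specialize (hstep n); lra. }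
  apply Rmult_le_reg_l with (1 := ht).
  replace (t * (1 + / t)) with (t + 1) by (field; lra).
  pose proof (Rpower_pos (idx n) (- t)); lra.
Qed.

(** For [s <= 1] the terms dominate those of the harmonic series, whose partial
    sums are bounded below by the logarithm. *)
Lemma sum_Rpower_unbounded s T : s <= 1 ->
  exists N, T < sum_n (fun n => Rpower (idx n) (- s)) N.
Proof.
intros hs.
assert (hN : forall n, ln (idx (S n)) <= sum_n (fun n => Rpower (idx n) (- s)) n).
{ assert (hinv : forall n, / idx n <= Rpower (idx n) (- s)).
  { intros n; pose proof (idx_ge1 n).
    rewrite <- (Rpower_1 (idx n)) at 1 by lra; rewrite <- Rpower_Ropp.
    apply Rle_Rpower; lra. }
  intros n; induction n as [|n IH].
  - rewrite sum_O; pose proof (ln_idx_step 0); specialize (hinv O).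
    replace (ln (idx 0)) with 0 in * by (symmetry; apply ln_1); lra.
  - rewrite sum_n_S; pose proof (ln_idx_step (S n)); specialize (hinv (S n)); lra. }
destruct (INR_unbounded (exp T)) as [N h]; exists N.
apply Rlt_le_trans with (2 := hN N); rewrite <- (ln_exp T); apply ln_increasing.
- apply exp_pos.
- apply Rlt_le_trans with (1 := h); apply le_INR; lia.
Qed.

Definition bose_term (s alpha : R) (n : nat) : R :=
  Rpower (idx n) (- s) * exp (- alpha * idx n).

Lemma bose_term_pos s alpha n : 0 < bose_term s alpha n.
Proof. apply Rmult_lt_0_compat; apply exp_pos. Qed.

Lemma exp_idx alpha n : exp (- alpha * idx n) = exp (- alpha) * exp (- alpha) ^ n.
Proof.
unfold idx; induction n as [|n IH].
- simpl; rewrite !Rmult_1_r; reflexivity.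
- rewrite S_INR, Rmult_plus_distr_l, exp_plus, IH; simpl; rewrite Rmult_1_r; ring.
Qed.

Lemma ex_series_bose s alpha : 0 <= s -> 0 < alpha -> ex_series (bose_term s alpha).
Proof.
intros hs ha.
apply ex_series_dominated with (b := fun n => exp (- alpha) * exp (- alpha) ^ n).
- intros n; split; [left; apply bose_term_pos|].
  unfold bose_term; rewrite <- exp_idx.
  pose proof (Rpower_idx_le_1 n s hs); pose proof (exp_pos (- alpha * idx n)); nra.
- apply (@ex_series_scal_l R_AbsRing R_NormedModule (exp (- alpha))), ex_series_geom.
  rewrite Rabs_pos_eq by (left; apply exp_pos).
  rewrite <- exp_0; apply exp_increasing; lra.
Qed.

Lemma is_series_bose s alpha : 0 <= s -> 0 < alpha ->
  is_series (bose_term s alpha) (bose s alpha).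
Proof. intros hs ha; apply Series_correct, ex_series_bose; assumption. Qed.

Lemma bose_decr s a b : 0 <= s -> 0 < a -> a < b -> bose s b < bose s a.
Proof.
intros hs ha hab.
assert (hlt : forall n, bose_term s b n < bose_term s a n).
{ intros n; apply Rmult_lt_compat_l; [apply exp_pos|].
  apply exp_increasing; pose proof (idx_ge1 n); nra. }
assert (h := is_series_add _ _ _ _ (is_series_bose s a hs ha)
  (is_series_mul (-1) _ _ (is_series_bose s b hs ltac:(lra)))).
assert (hpos : forall n, 0 <= bose_term s a n + -1 * bose_term s b n)
  by (intros n; specialize (hlt n); lra).
pose proof (term_le_is_series _ _ O hpos h) as h0.
specialize (hlt O); lra.
Qed.

Lemma bose_PSeries s alpha :
  bose s alpha = exp (- alpha) * PSeries (fun n => Rpower (idx n) (- s)) (exp (- alpha)).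
Proof.
unfold bose, PSeries; rewrite <- Series_scal_l; apply Series_ext.
intros n; rewrite exp_idx; ring.
Qed.

Lemma CV_radius_Rpower s x : 0 <= s -> 0 <= x < 1 ->
  Rbar_lt (Rabs x) (CV_radius (fun n => Rpower (idx n) (- s))).
Proof.
intros hs hx; apply Rbar_lt_le_trans with (Finite 1).
- simpl; rewrite Rabs_pos_eq; lra.
- apply (proj1 (CV_radius_bounded (fun n => Rpower (idx n) (- s)))).
  exists 1; intros n; rewrite pow1, Rmult_1_r, Rabs_pos_eq by (left; apply exp_pos).
  apply Rpower_idx_le_1, hs.
Qed.

(** In the variable [x = exp (- alpha)] the Bose function is a power
    series vanishing at [0], so by continuity it takes every value below any
    of its values. If a partial sum of the series at [alpha = 0] exceeds [T],
    then so does the Bose function at small [alpha]. *)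
Lemma bose_attains s T N : 0 <= s -> 0 < T ->
  T < sum_n (fun n => Rpower (idx n) (- s)) N ->
  exists alpha, 0 < alpha /\ bose s alpha = T.
Proof.
intros hs hT; set (a := fun n => Rpower (idx n) (- s)).
set (A := sum_n a N : R); intros hA.
pose proof (idx_ge1 N) as hN.
assert (hln : 0 < ln (A / T)).
{ rewrite <- ln_1; apply ln_increasing; [lra|].
  apply Rmult_lt_reg_r with (1 := hT).
  replace (A / T * T) with A by (field; lra); lra. }
(* With this choice exp (- a0 * idx N), the smallest of the first N + 1
   exponential factors, is sqrt (T / A), so more than T remains of the partial
   sum A. *)
set (a0 := ln (A / T) / (2 * idx N)).
assert (ha0 : 0 < a0) by (apply Rdiv_lt_0_compat; lra).
assert (hbig : T < bose s a0).
{ apply Rlt_le_trans with (exp (- a0 * idx N) * A).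
  - replace (- a0 * idx N) with (- (ln (A / T) / 2)) by (unfold a0; field; lra).
    rewrite <- (Rmult_1_r T) at 1.
    replace (exp (- (ln (A / T) / 2)) * A)
      with (T * exp (ln (A / T) / 2)).
    + apply Rmult_lt_compat_l; [exact hT|].
      rewrite <- exp_0; apply exp_increasing; lra.
    + replace A with (T * exp (ln (A / T))) at 3.
      * replace (ln (A / T)) with (ln (A / T) / 2 + ln (A / T) / 2) at 3 by field.
        rewrite exp_plus, exp_Ropp; field; apply Rgt_not_eq, exp_pos.
      * rewrite exp_ln by (apply Rdiv_lt_0_compat; lra); field; lra.
  - apply Rle_trans with (sum_n (bose_term s a0) N).
    + assert (h : forall m, (m <= N)%nat ->
        exp (- a0 * idx N) * sum_n a m <= sum_n (bose_term s a0) m).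
      { assert (hk : forall k, (k <= N)%nat -> exp (- a0 * idx N) * a k <= bose_term s a0 k).
        { intros k hk; unfold bose_term; fold (a k); rewrite Rmult_comm.
          apply Rmult_le_compat_l; [left; apply exp_pos|].
          pose proof (idx_le k N hk).
          destruct (Rle_lt_or_eq_dec (- a0 * idx N) (- a0 * idx k) ltac:(nra)) as [h1| ->].
          - left; apply exp_increasing, h1.
          - right; reflexivity. }
        intros m; induction m as [|m IH]; intros hm.
        - rewrite !sum_O; apply hk, hm.
        - rewrite !sum_n_S, Rmult_plus_distr_l.
          specialize (IH ltac:(lia)); specialize (hk (S m) hm); lra. }
      exact (h N (le_n N)).
    + apply sum_n_le_is_series; [intros k; left; apply bose_term_pos|].
      apply is_series_bose; assumption. }
set (G := fun x => x * PSeries a x).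
assert (hcont : forall x, 0 <= x < 1 -> continuity_pt G x).
{ intros x hx; apply (continuity_pt_mult (fun x => x) (PSeries a)).
  - apply continuity_pt_id.
  - apply PSeries_continuity, CV_radius_Rpower; assumption. }
assert (hx1 : 0 < exp (- a0) < 1).
{ split; [apply exp_pos|rewrite <- exp_0; apply exp_increasing; lra]. }
destruct (IVT_Rbar_incr G 0 (exp (- a0)) (G 0) (G (exp (- a0))) T) as [x [hx0 [hxl hx]]].
- apply is_lim_continuity, hcont; lra.
- apply is_lim_continuity, hcont; lra.
- intros x h0 h1; apply hcont; simpl in h0, h1; lra.
- exact (proj1 hx1).
- unfold G at 1; rewrite Rmult_0_l; split; [exact hT|].
  rewrite bose_PSeries in hbig; exact hbig.
- simpl in hx0, hxl; exists (- ln x); split.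
  + assert (ln x < 0); [|lra].
    rewrite <- ln_1; apply ln_increasing; lra.
  + rewrite bose_PSeries, Ropp_involutive, exp_ln by exact hx0; exact hx.
Qed.

Lemma thermal_pos d beta : 0 < thermal d beta.
Proof. apply exp_pos. Qed.

Lemma is_alpha_bose d beta rho alpha :
  is_alpha d beta rho alpha <->
  0 < alpha /\ bose (INR d / 2) alpha = rho * thermal d beta.
Proof.
pose proof (thermal_pos d beta) as h; unfold is_alpha.
split; intros [ha he]; split; try exact ha.
- rewrite he; field; lra.
- rewrite he; field; lra.
Qed.

(** The critical density is, in every dimension, the supremum of these partial
    sums divided by the thermal factor: in dimensions one and two the series
    diverges. *)
Lemma sum_Rpower_above d (beta rho : R) : (1 <= d)%nat -> Rbar_lt rho (rho_c d beta) ->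
  exists N, rho * thermal d beta < sum_n (fun n => Rpower (idx n) (- (INR d / 2))) N.
Proof.
intros hd; unfold rho_c; destruct (Nat.leb_spec d 2) as [h2|h3]; intros hlt.
- apply sum_Rpower_unbounded; apply le_INR in h2; simpl in h2; lra.
- change (rho < / thermal d beta * zeta (INR d / 2)) in hlt.
  set (T := rho * thermal d beta); set (a := fun n => Rpower (idx n) (- (INR d / 2))).
  assert (hT : T < zeta (INR d / 2)).
  { pose proof (thermal_pos d beta) as ht.
    apply Rmult_lt_compat_r with (1 := ht) in hlt.
    replace (/ thermal d beta * zeta (INR d / 2) * thermal d beta)
      with (zeta (INR d / 2)) in hlt by (field; lra); exact hlt. }
  assert (hs : is_series a (zeta (INR d / 2))).
  { apply Series_correct, ex_series_zeta.
    apply le_INR in h3; simpl in h3; lra. }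
  destruct (proj2 (is_lim_seq_spec (sum_n a) (zeta (INR d / 2))) hs
    (mkposreal (zeta (INR d / 2) - T) ltac:(lra))) as [N hN].
  exists N; specialize (hN N (le_n N)); simpl in hN.
  apply Rabs_lt_between in hN; lra.
Qed.

Lemma exists_unique_alpha d beta rho : (1 <= d)%nat -> 0 < rho ->
  Rbar_lt rho (rho_c d beta) -> exists! alpha, is_alpha d beta rho alpha.
Proof.
intros hd hr hlt; assert (hs : 0 <= INR d / 2) by (pose proof (pos_INR d); lra).
destruct (sum_Rpower_above d beta rho hd hlt) as [N hN].
destruct (bose_attains _ _ N hs
  (Rmult_lt_0_compat _ _ hr (thermal_pos d beta)) hN) as [alpha [ha he]].
exists alpha; split; [apply is_alpha_bose; split; assumption|].
intros a' h'; apply is_alpha_bose in h'; destruct h' as [ha' he'].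
destruct (Rtotal_order alpha a') as [h|[h|h]]; [exfalso|exact h|exfalso].
- pose proof (bose_decr _ _ _ hs ha h); lra.
- pose proof (bose_decr _ _ _ hs ha' h); lra.
Qed.

(** * The variational problem *)

Lemma hatQstar_eq d beta rho n : 0 < rho ->
  hatQstar d beta rho n
  = / (rho * thermal d beta) * Rpower (idx n) (- (1 + INR d / 2)).
Proof.
intros hr; unfold hatQstar; rewrite Rpower_Ropp.
pose proof (thermal_pos d beta); pose proof (Rpower_pos (idx n) (1 + INR d / 2)).
field; lra.
Qed.

Lemma is_series_tilted d beta rho alpha : 0 < rho -> 0 < alpha ->
  is_series (tilted d beta rho alpha)
    (/ (rho * thermal d beta) * bose ((INR d + 2) / 2) alpha).
Proof.
intros hr ha; pose proof (pos_INR d).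
apply is_series_eq
  with (1 := is_series_mul (/ (rho * thermal d beta)) _ _
               (is_series_bose ((INR d + 2) / 2) alpha ltac:(lra) ha)); [|reflexivity].
intros n; unfold tilted, bose_term; rewrite hatQstar_eq by exact hr.
replace (- ((INR d + 2) / 2)) with (- (1 + INR d / 2)) by field; ring.
Qed.

(** The equation defining [alpha] is the normalisation of the tilted weights. *)
Lemma is_series_idx_tilted d beta rho alpha : 0 < rho -> is_alpha d beta rho alpha ->
  is_series (fun n => idx n * tilted d beta rho alpha n) 1.
Proof.
intros hr ha; apply is_alpha_bose in ha; destruct ha as [ha he]; pose proof (pos_INR d).
apply is_series_eq
  with (1 := is_series_mul (/ (rho * thermal d beta)) _ _
               (is_series_bose (INR d / 2) alpha ltac:(lra) ha)).
- intros n; unfold tilted, bose_term; rewrite hatQstar_eq by exact hr.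
  rewrite <- Rpower_idx_mul; ring.
- rewrite he; pose proof (thermal_pos d beta); field; lra.
Qed.

Section Subcritical.

Context (d : nat) (beta rho alpha : R) (hb : 0 < beta) (hr : 0 < rho).
Context (ha : is_alpha d beta rho alpha).

Let p := tilted d beta rho alpha.
Let L := / (rho * thermal d beta) * bose ((INR d + 2) / 2) alpha.

Let hL : is_series p L.
Proof. apply is_series_tilted; [exact hr|exact (proj1 ha)]. Qed.

Lemma in_M_tail_tilted : in_M (tail p).
Proof.
apply in_M_tail; [intros n; left; apply tilted_pos, hr|].
apply is_series_idx_tilted; assumption.
Qed.

Lemma hat_tail_tilted n : hat (tail p) n = p n.
Proof. apply hat_tail; exists L; exact hL. Qed.

Lemma calS_tail_tilted : calS d beta rho (tail p) = - L - alpha.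
Proof.
exact (calS_of_hat d beta rho alpha L hb hr hL (tail p) in_M_tail_tilted hat_tail_tilted).
Qed.

Lemma minimiser_tail_tilted : minimiser d beta rho (tail p).
Proof.
split; [exact in_M_tail_tilted|].
intros Q' hQ'; rewrite calS_tail_tilted; exact (calS_ge d beta rho alpha L hb hr hL Q' hQ').
Qed.

Lemma minimiser_unique Q : minimiser d beta rho Q -> Q = tail p.
Proof.
intros [hQ hmin]; specialize (hmin (tail p) in_M_tail_tilted); rewrite calS_tail_tilted in hmin.
pose proof (calS_ge d beta rho alpha L hb hr hL Q hQ) as hge.
apply hat_inj; [apply in_M_lim, hQ|apply in_M_lim, in_M_tail_tilted|].
intros n; rewrite hat_tail_tilted.
apply (calS_eq_hat d beta rho alpha L hb hr hL Q hQ); lra.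
Qed.

Lemma free_energy_subcritical :
  free_energy d beta rho
  = Finite (- (/ (thermal d beta * beta) * bose ((INR d + 2) / 2) alpha)
            - / beta * rho * alpha).
Proof.
unfold free_energy; rewrite (infS_eq d beta rho (- L - alpha) (fun _ => tail p)).
- simpl; f_equal; unfold L; pose proof (thermal_pos d beta); field; lra.
- exact (calS_ge d beta rho alpha L hb hr hL).
- intros _; exact in_M_tail_tilted.
- rewrite <- calS_tail_tilted; apply is_lim_seq_const.
Qed.

End Subcritical.

Section Supercritical.

Context (d : nat) (beta rho : R) (hb : 0 < beta) (hr : 0 < rho).
Context (hd : (3 <= d)%nat) (hc : Rbar_lt (rho_c d beta) rho).

Let L := / (rho * thermal d beta) * zeta ((INR d + 2) / 2).

Let hd2 : 3 <= INR d.
Proof. apply le_INR in hd; simpl in hd; lra. Qed.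

Lemma is_series_hatQstar : is_series (hatQstar d beta rho) L.
Proof.
apply is_series_eq with (1 := is_series_mul (/ (rho * thermal d beta)) _ _
  (Series_correct _ (ex_series_zeta ((INR d + 2) / 2) ltac:(lra)))); [|reflexivity].
intros n; rewrite hatQstar_eq by exact hr.
replace (- ((INR d + 2) / 2)) with (- (1 + INR d / 2)) by field; reflexivity.
Qed.

(** The first moment of the reference weights is [rho_c / rho]: the critical
    density is where they stop being able to carry the full mass. *)
Lemma moment_hatQstar :
  exists m, m < 1 /\ is_series (fun n => idx n * hatQstar d beta rho n) m.
Proof.
exists (/ (rho * thermal d beta) * zeta (INR d / 2)); split.
- unfold rho_c in hc; rewrite (proj2 (Nat.leb_gt d 2)) in hc by lia; cbn [Rbar_lt] in hc.
  rewrite Rinv_mult, Rmult_assoc; apply Rmult_lt_reg_l with (1 := hr).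
  rewrite <- Rmult_assoc, Rinv_r by lra; lra.
- apply is_series_eq with (1 := is_series_mul (/ (rho * thermal d beta)) _ _
    (Series_correct _ (ex_series_zeta (INR d / 2) ltac:(lra)))); [|reflexivity].
  intros n; rewrite hatQstar_eq, <- Rpower_idx_mul by exact hr; ring.
Qed.

Lemma Qstar_approximable :
  exists Qn : nat -> nat -> R, (forall n, in_M (Qn n)) /\ converges Qn (Qstar d beta rho).
Proof.
destruct moment_hatQstar as [m [hm hs]].
assert (h0 : forall n, 0 <= hatQstar d beta rho n) by (intros n; left; apply hatQstar_pos, hr).
assert (hex : ex_series (hatQstar d beta rho)) by (exists L; exact is_series_hatQstar).
apply (approximable (tail (hatQstar d beta rho)) m).
- intros n; apply tail_nonneg; assumption.
- intros n; apply tail_decr; assumption.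
- apply is_series_tail; assumption.
- lra.
Qed.

Lemma infS_supercritical : infS d beta rho = Finite (- L).
Proof.
destruct Qstar_approximable as [Qn [hQ hconv]].
apply (infS_eq d beta rho (- L) Qn).
- intros Q hM.
  pose proof (calS_ge d beta rho 0 L hb hr
    (is_series_tilted_0 d beta rho L is_series_hatQstar) Q hM); lra.
- exact hQ.
- apply is_lim_seq_calS; [exact hb|exact hr|exact is_series_hatQstar|exact hQ|exact hconv].
Qed.

(** Attaining the infimum forces the increments to be the reference weights,
    whose first moment is too small. *)
Lemma no_minimiser Q : ~ minimiser d beta rho Q.
Proof.
intros [hQ hmin].
destruct Qstar_approximable as [Qn [hQn hconv]].
assert (hlim := is_lim_seq_calS d beta rho L hb hr is_series_hatQstar Qn hQn hconv).
assert (hle := is_lim_seq_le _ _ _ _ (fun n => hmin (Qn n) (hQn n))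
  (is_lim_seq_const (calS d beta rho Q)) hlim); simpl in hle.
assert (h0 := is_series_tilted_0 d beta rho L is_series_hatQstar).
pose proof (calS_ge d beta rho 0 L hb hr h0 Q hQ).
assert (he := calS_eq_hat d beta rho 0 L hb hr h0 Q hQ ltac:(lra)).
destruct moment_hatQstar as [m [hm hs]].
assert (h1 := is_series_idx_hat Q hQ).
apply is_series_unique in h1; apply is_series_unique in hs.
assert (hm1 : m = 1); [|lra].
rewrite <- hs, <- h1; apply Series_ext; intros n; rewrite he.
unfold tilted; rewrite Ropp_0, Rmult_0_l, exp_0; ring.
Qed.

Lemma is_lim_seq_calS_infS (Qn : nat -> nat -> R) :
  (forall n, in_M (Qn n)) -> converges Qn (Qstar d beta rho) ->
  is_lim_seq (fun n => calS d beta rho (Qn n)) (infS d beta rho).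
Proof.
intros hQ hconv; rewrite infS_supercritical.
apply is_lim_seq_calS; [exact hb|exact hr|exact is_series_hatQstar|exact hQ|exact hconv].
Qed.

Lemma free_energy_supercritical :
  free_energy d beta rho
  = Finite (- (/ (thermal d beta * beta) * zeta ((INR d + 2) / 2))).
Proof.
unfold free_energy; rewrite infS_supercritical; simpl; f_equal; unfold L.
pose proof (thermal_pos d beta); field; lra.
Qed.

End Supercritical.

Theorem theorem2p5 (d : nat) (beta rho : R)
  (hd : (1 <= d)%nat) (hbeta : 0 < beta) (hrho : 0 < rho) :
  (* existence and uniqueness of alpha = alpha(beta, rho) *)
  (Rbar_lt (Finite rho) (rho_c d beta) ->
     exists! alpha : R, is_alpha d beta rho alpha) /\
  (* (1) *)
  ((d = 1%nat \/ d = 2%nat \/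
    ((3 <= d)%nat /\ Rbar_lt (Finite rho) (rho_c d beta))) ->
     forall alpha : R, is_alpha d beta rho alpha ->
     exists Q : nat -> R,
       minimiser d beta rho Q /\
       (forall Q', minimiser d beta rho Q' -> Q' = Q) /\
       (forall n : nat,
          hat Q n = exp (- alpha * idx n) /
                    (rho * thermal d beta * Rpower (idx n) (1 + INR d / 2)))) /\
  (* (2) *)
  ((3 <= d)%nat -> Rbar_lt (rho_c d beta) (Finite rho) ->
     ~ (exists Q : nat -> R, minimiser d beta rho Q) /\
     (exists Qn : nat -> nat -> R,
        (forall n, in_M (Qn n)) /\ converges Qn (Qstar d beta rho)) /\
     (forall Qn : nat -> nat -> R,
        (forall n, in_M (Qn n)) -> converges Qn (Qstar d beta rho) ->
        is_lim_seq (fun n => calS d beta rho (Qn n)) (infS d beta rho))) /\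
  (* (3) *)
  ((3 <= d)%nat ->
     (Rbar_lt (Finite rho) (rho_c d beta) ->
        forall alpha : R, is_alpha d beta rho alpha ->
        free_energy d beta rho =
          Finite (- (/ (thermal d beta * beta) * bose ((INR d + 2) / 2) alpha)
                  - / beta * rho * alpha)) /\
     (Rbar_lt (rho_c d beta) (Finite rho) ->
        free_energy d beta rho =
          Finite (- (/ (thermal d beta * beta) * zeta ((INR d + 2) / 2))))) /\
  ((d = 1%nat \/ d = 2%nat) ->
     forall alpha : R, is_alpha d beta rho alpha ->
     free_energy d beta rho =
       Finite (- (/ (thermal d beta * beta) * bose ((INR d + 2) / 2) alpha)
               - rho * alpha / beta)).
Proof.
split; [intros hlt; apply exists_unique_alpha; assumption|split].
{ intros _ alpha ha; exists (tail (tilted d beta rho alpha)).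
  split; [apply minimiser_tail_tilted; assumption|split].
  - intros Q' h; apply minimiser_unique; assumption.
  - intros n; rewrite hat_tail_tilted by assumption; reflexivity. }
split.
{ intros h3 hc; split; [|split].
  - intros [Q hQ]; exact (no_minimiser d beta rho hbeta hrho h3 hc Q hQ).
  - exact (Qstar_approximable d beta rho hrho h3 hc).
  - exact (is_lim_seq_calS_infS d beta rho hbeta hrho h3 hc). }
split.
{ intros h3; split.
  - intros _ alpha ha; apply free_energy_subcritical; assumption.
  - intros hc; apply free_energy_supercritical; assumption. }
intros _ alpha ha; rewrite (free_energy_subcritical d beta rho alpha hbeta hrho ha).
f_equal; pose proof (thermal_pos d beta); field; lra.
Qed.
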